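(* Fix a set partition $\mathcal B=\{B_1,\dots,B_k\}$ of $[n]$ with $\min B_1<\cdots<\min B_k$, and let $X=\{(i,j): i<j,\ B_i,B_j \text{ nested}\}$. For each $A\subseteq X$ let $W_A$ be the set of packed words $w$ with $\mathrm{setpar}(w)=\mathcal B$, $A\subseteq\mathrm{Inv}(w)$ and $(X\setminus A)\cap\mathrm{Inv}(w)=\emptyset$. Then each nonempty $W_A$ is a connected component of the planar weak order on packed words of length $n$, and every connected component arises this way. Each connected component $W$ is a bounded lattice, order-isomorphic via $\mathrm{delrpt}$ to an interval of the weak order on $S_k$; in particular for $u,w\in W$, $$u\vee w=\mathrm{pw}(\mathcal B,\mathrm{delrpt}(u)\vee\mathrm{delrpt}(w)),\qquad u\wedge w=\mathrm{pw}(\mathcal B,\mathrm{delrpt}(u)\wedge\mathrm{delrpt}(w)).$$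
   Context: A packed word is a word $w=w_1\cdots w_n$ of positive integers whose set of letters is $\{1,\dots,m\}$ for some $m$; $w^{-1}(a)=\{p:w_p=a\}$. $\mathrm{iInv}(w)=\{(a,b):a<b,\ \min w^{-1}(a)>\max w^{-1}(b)\}$. $T_a(w)$ swaps the letters $a$ and $a+1$ in $w$. The planar weak order on packed words of length $n$ is the reflexive–transitive closure of: $u$ is covered by $w$ iff $u=T_a(w)$ for some $a$ and $|\mathrm{iInv}(w)|=|\mathrm{iInv}(u)|+1$; connected components are those of its Hasse diagram. $\mathrm{setpar}(w)$ is the set partition of $[n]$ into the nonempty fibres $w^{-1}(a)$. If its blocks are $B_1,\dots,B_k$ with $\min B_1<\cdots<\min B_k$ and $b_i=\min B_i$, then $\mathrm{delrpt}(w)$ is the permutation $w_{b_1}w_{b_2}\cdots w_{b_k}\in S_k$ (first occurrences of each letter) and $\mathrm{Inv}(w)=\{(i,j):i<j,\ w_{b_i}>w_{b_j}\}$. Conversely for such $\mathcal B$ and $\sigma\in S_k$, $\mathrm{pw}(\mathcal B,\sigma)$ is the packed word with letter $\sigma(i)$ at every position of $B_i$. Two blocks $B_i,B_j$ are nested if $\min B_i<\min B_j<\max B_i$. The weak order on $S_k$: $\sigma\le\tau$ iff $\mathrm{Inv}(\sigma)\subseteq\mathrm{Inv}(\tau)$, where $\mathrm{Inv}(\sigma)=\{(i,j):i<j,\sigma(i)>\sigma(j)\}$; it is a lattice with join $\vee$ and meet $\wedge$. *)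

(* Defs.v *)
From Stdlib Require Import Relations.
From mathcomp Require Import all_boot all_fingroup.

Set Implicit Arguments.
Unset Strict Implicit.
Unset Printing Implicit Defensive.

(* Conventions: a word of length n is an [n.-tuple nat]; positions are
   0-based ('I_n instead of [n]); letters are positive integers.
   Blocks are indexed 0..k-1 ('I_k) instead of 1..k; a permutation
   sigma in S_k is a [{perm 'I_k}], the paper's value sigma(i) being
   our (sigma i).+1. *)

Definition maxletter (w : seq nat) : nat := \max_(x <- w) x.

Definition packed (w : seq nat) : bool :=
  (0 \notin w) && all (fun b => b \in w) (iota 1 (maxletter w)).

Definition minpos (a : nat) (w : seq nat) : nat := index a w.
Definition maxpos (a : nat) (w : seq nat) : nat := (size w).-1 - index a (rev w).

Definition iInv (w : seq nat) : seq (nat * nat) :=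
  [seq ab <- [seq (a, b) | a <- undup w, b <- undup w]
     | (ab.1 < ab.2) && (maxpos ab.2 w < minpos ab.1 w)].

Definition swapl (a x : nat) : nat :=
  if x == a then a.+1 else if x == a.+1 then a else x.

Definition Ta {n : nat} (a : nat) (w : n.-tuple nat) : n.-tuple nat :=
  map_tuple (swapl a) w.

Definition covers {n : nat} (u w : n.-tuple nat) : Prop :=
  packed u /\ packed w /\ (exists a, u = Ta a w) /\
  size (iInv w) = (size (iInv u)).+1.

Definition pwle {n : nat} : relation (n.-tuple nat) :=
  clos_refl_trans (n.-tuple nat) covers.

Definition conn {n : nat} : relation (n.-tuple nat) :=
  clos_refl_sym_trans (n.-tuple nat) covers.

Definition inComp {n : nat} (w0 u : n.-tuple nat) : Prop :=
  packed u /\ conn u w0.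

Definition setpar {n : nat} (w : n.-tuple nat) : {set {set 'I_n}} :=
  [set [set q : 'I_n | tnth w q == tnth w p] | p : 'I_n].

Definition minb {n : nat} (C : {set 'I_n}) : nat := \big[minn/n]_(p in C) (p : nat).
Definition maxb {n : nat} (C : {set 'I_n}) : nat := \max_(p in C) (p : nat).

Definition leaders {n : nat} (B : {set {set 'I_n}}) : seq 'I_n :=
  [seq p <- enum 'I_n | [forall q in pblock B p, (p <= q)%N]].

Definition blocks {n : nat} (B : {set {set 'I_n}}) : seq {set 'I_n} :=
  [seq pblock B p | p <- leaders B].

Definition blk {n : nat} (B : {set {set 'I_n}}) (i : nat) : {set 'I_n} :=
  nth set0 (blocks B) i.

Definition nested {n : nat} (C D : {set 'I_n}) : bool :=
  (minb C < minb D) && (minb D < maxb C).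

Definition Xset {n : nat} (B : {set {set 'I_n}}) : {set 'I_#|B| * 'I_#|B|} :=
  [set ij : 'I_#|B| * 'I_#|B| | (ij.1 < ij.2)%N && nested (blk B ij.1) (blk B ij.2)].

Definition lead_letter {n : nat} (B : {set {set 'I_n}}) (w : n.-tuple nat) (i : nat) : nat :=
  nth 0 w (minb (blk B i)).

Definition InvW {n : nat} (B : {set {set 'I_n}}) (w : n.-tuple nat)
  : {set 'I_#|B| * 'I_#|B|} :=
  [set ij : 'I_#|B| * 'I_#|B| | (ij.1 < ij.2)%N && (lead_letter B w ij.2 < lead_letter B w ij.1)].

(* delrpt(w) = w_{b_1} ... w_{b_k} in S_k (here B = setpar w) *)
Definition delrpt_ffun {n : nat} (B : {set {set 'I_n}}) (w : n.-tuple nat)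
  : {ffun 'I_#|B| -> 'I_#|B|} :=
  [ffun i : 'I_#|B| => insubd i (lead_letter B w i).-1].

Definition delrpt {n : nat} (B : {set {set 'I_n}}) (w : n.-tuple nat)
  : {perm 'I_#|B|} := insubd (1%g : {perm 'I_#|B|}) (delrpt_ffun B w).

Definition pw {n : nat} (B : {set {set 'I_n}}) (s : {perm 'I_#|B|}) : n.-tuple nat :=
  [tuple nth 0 [seq (s i : nat).+1 | i <- enum 'I_#|B|] (index (pblock B p) (blocks B))
   | p < n].

Definition inWA {n : nat} (B : {set {set 'I_n}}) (A : {set 'I_#|B| * 'I_#|B|})
  (w : n.-tuple nat) : Prop :=
  packed w /\ setpar w = B /\ A \subset InvW B w /\
  (Xset B :\: A) :&: InvW B w = set0.

Definition invp {k : nat} (s : {perm 'I_k}) : {set 'I_k * 'I_k} :=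
  [set ij : 'I_k * 'I_k | (ij.1 < ij.2)%N && (s ij.2 < s ij.1)%N].

Definition weak_le {k : nat} (s t : {perm 'I_k}) : bool := invp s \subset invp t.

Definition weak_is_join {k : nat} (s t j : {perm 'I_k}) : bool :=
  [&& weak_le s j, weak_le t j & [forall x, weak_le s x ==> weak_le t x ==> weak_le j x]].

Definition weak_is_meet {k : nat} (s t j : {perm 'I_k}) : bool :=
  [&& weak_le j s, weak_le j t & [forall x, weak_le x s ==> weak_le x t ==> weak_le x j]].

Definition wjoin {k : nat} (s t : {perm 'I_k}) : {perm 'I_k} :=
  odflt s [pick j | weak_is_join s t j].
Definition wmeet {k : nat} (s t : {perm 'I_k}) : {perm 'I_k} :=
  odflt s [pick j | weak_is_meet s t j].

Definition is_joinW {n : nat} (W : n.-tuple nat -> Prop) (u v j : n.-tuple nat) : Prop :=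
  W j /\ pwle u j /\ pwle v j /\
  (forall x, W x -> pwle u x -> pwle v x -> pwle j x).

Definition is_meetW {n : nat} (W : n.-tuple nat -> Prop) (u v j : n.-tuple nat) : Prop :=
  W j /\ pwle j u /\ pwle j v /\
  (forall x, W x -> pwle x u -> pwle x v -> pwle x j).

Arguments inWA {n} B A w.
Arguments pw {n} B s.
Arguments delrpt {n} B w.
Arguments InvW {n} B w.
Arguments Xset {n} B.

(* Main.v *)
Require Import Defs.
From Stdlib Require Import Relations.
From mathcomp Require Import all_boot all_fingroup.
From mathcomp Require Import zify.

Set Implicit Arguments.
Unset Strict Implicit.
Unset Printing Implicit Defensive.

(** A packed word [w] with [setpar w = B] is [pw B s] for a unique permutation
    [s], and [iInv (pw B s)] corresponds to the inversions of [s] outside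
    [X = Xset B].  A cover therefore adds to [s] exactly one inversion, lying
    outside [X], so [X :&: invp s] is constant on connected components.
    Conversely, if [s] is below [t] in the weak order and both have the same
    trace on [X], then some pair of adjacent values of [s] inverted in [t] can be
    exchanged, and this is a cover; hence [pw B s] is below [pw B t].

    The inversion set of the join of [s] and [t] is the transitive closure of
    [invp s :|: invp t].  Since [(i, l)] in [X] and [i < j < l] imply [(i, j)] in
    [X], a chain of inversions from [i] to [l] with [(i, l)] in [X] only meets
    pairs [(i, _)] of [X], so the trace on [X] is preserved by joins and, composing
    with the order reversal of the values, by meets.  A class of permutations with
    a given trace on [X] is thus a convex sublattice, hence an interval. *)

(** * The weak order *)

Section WeakOrder.
Variable k : nat.
Implicit Types (s t r : {perm 'I_k}) (i j l : 'I_k) (I J X : {set 'I_k * 'I_k}).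

(** * Permutations and their inversion sets *)

Lemma mem_invp s i j : ((i, j) \in invp s) = (i < j) && (s j < s i).
Proof. by rewrite inE. Qed.

Lemma perm_neq_ltn s i j : i != j -> (s i < s j) || (s j < s i).
Proof.
move=> neq_ij; rewrite -neq_ltn; apply: contra neq_ij => /eqP/val_inj/perm_inj->.
exact: eqxx.
Qed.

Lemma perm_ltn_invp s i j :
  (s j < s i) = if j < i then (j, i) \notin invp s else (i, j) \in invp s.
Proof.
rewrite !mem_invp; case: (ltngtP j i) => [lt_ji|lt_ij|/val_inj->] /=; last exact: ltnn.
  have := @perm_neq_ltn s j i; rewrite neq_ltn lt_ji => /(_ isT).
  by case: ltngtP.
by [].
Qed.

Lemma card_ord_ltn m : m <= k -> #|[set x : 'I_k | x < m]| = m.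
Proof.
move=> le_mk; have inj_w : injective (widen_ord le_mk) by move=> x y [] /val_inj.
rewrite -[RHS]card_ord -(card_imset _ inj_w).
apply: eq_card => x; rewrite inE; apply/idP/imsetP => [lt_xm|[y _ ->] /=].
  by exists (Ordinal lt_xm) => //; apply: val_inj.
exact: ltn_ord.
Qed.

Lemma perm_rank s i : #|[set j | s j < s i]| = s i.
Proof.
rewrite -[RHS](card_ord_ltn (ltnW (ltn_ord (s i)))).
rewrite -[RHS](card_preimset _ (@perm_inj _ s)).
by apply: eq_card => j; rewrite !inE.
Qed.

(** Each value is the number of values below it, and by [perm_ltn_invp] these comparisons are read
    off from the inversion set. *)
Lemma invp_inj : injective (@invp k).
Proof.
move=> s t eq_st; apply/permP => i; apply: val_inj.
rewrite /= -perm_rank -[RHS]perm_rank; apply: eq_card => j.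
by rewrite !inE !perm_ltn_invp eq_st.
Qed.

Lemma weak_le_refl s : weak_le s s. Proof. exact: subxx. Qed.

Lemma weak_le_trans t s r : weak_le s t -> weak_le t r -> weak_le s r.
Proof. exact: subset_trans. Qed.

Lemma weak_le_anti s t : weak_le s t -> weak_le t s -> s = t.
Proof. by move=> st ts; apply/invp_inj/eqP; rewrite eqEsubset; apply/andP. Qed.

Lemma weak_leP s t :
  reflect (forall i j, (i, j) \in invp s -> (i, j) \in invp t) (weak_le s t).
Proof. by apply: (iffP subsetP) => [sub i j /sub|sub [i j] /sub]. Qed.

(** The classical description of inversion sets: the last clause is transitivity of the complement
    among increasing pairs, in contrapositive form. *)
Definition biclosed I :=
  [/\ forall i j, (i, j) \in I -> i < j,
      forall i j l, (i, j) \in I -> (j, l) \in I -> (i, l) \in I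
    & forall i j l, (i, l) \in I -> i < j -> j < l -> (i, j) \in I \/ (j, l) \in I].

Lemma biclosed_invp s : biclosed (invp s).
Proof.
split=> [i j|i j l|i j l]; rewrite !mem_invp; first by case/andP.
  by move=> /andP[ij sji] /andP[jl slj]; rewrite (ltn_trans ij) //= (ltn_trans slj).
case/andP=> il sli -> ->/=.
by case: (leqP (s i) (s j)); [right; apply: leq_trans sli _ | left].
Qed.

(** Read through the formula of [perm_ltn_invp], [I] prescribes how any two values compare.
    Biclosedness makes this relation [lt] a strict total order, and the rank [f] of a position under
    it is its value. *)
Lemma invp_surj I : biclosed I -> exists s, invp s = I.
Proof.
case=> ltI trI coI.
pose lt j i := if j < i then (j, i) \notin I else (i, j) \in I.
have ltxx i : lt i i = false by rewrite /lt ltnn; apply/negP => /ltI; rewrite ltnn.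
have lt_total i j : i != j -> lt i j || lt j i.
  rewrite /lt -val_eqE /=; case: ltngtP => // _ _; first by rewrite orNb.
  by rewrite orbN.
(* Each of the six relative orders of three distinct positions takes one use of [trI] or [coI]. *)
have lt_trans : transitive lt.
  move=> b a c; rewrite /lt.
  case: (ltngtP a b) => [ab|ba|/val_inj <-{b}]; last first.
  - by move=> /ltI; rewrite ltnn.
  - case: (ltngtP b c) => [bc|cb|/val_inj <-{c}]; last first.
    + by move=> _ /ltI; rewrite ltnn.
    + by move=> baI cbI; rewrite ltnNge ltnW ?(ltn_trans cb) //= (trI _ _ _ cbI baI).
    case: (ltngtP a c) => [ac|ca|/val_inj <-{c bc}] baI bcI.
    + by apply: contra bcI => /(trI _ _ _ baI).
    + by case: (coI _ _ _ baI bc ca) bcI => // ->.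
    + by rewrite baI in bcI.
  case: (ltngtP b c) => [bc|cb|/val_inj <-{c}]; last first.
  - by move=> _ /ltI; rewrite ltnn.
  - case: (ltngtP a c) => [ac|ca|/val_inj <-{c cb}] abI cbI.
    + by apply: contra abI => /trI; apply.
    + by case: (coI _ _ _ cbI ca ab) abI => // ->.
    + by rewrite cbI in abI.
  move=> abI bcI; rewrite (ltn_trans ab bc); apply/negP => /coI/(_ ab bc).
  by case; apply/negP.
pose f i := #|[set j | lt j i]|.
have f_lt i : f i < k.
  rewrite -[X in _ < X]card_ord -cardsT; apply: proper_card; rewrite properT.
  by apply/negP => /eqP/setP/(_ i); rewrite !inE ltxx.
have f_mono i j : lt j i -> f j < f i.
  move=> ji; apply: proper_card; apply/properP; split.
    by apply/subsetP => l; rewrite !inE => /lt_trans; apply.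
  by exists j; rewrite inE ?ltxx.
have f_inj : injective (fun i => Ordinal (f_lt i)).
  move=> i j [eq_f]; apply/eqP; apply/negPn/negP => /lt_total.
  by case/orP=> /f_mono; rewrite eq_f ltnn.
exists (perm f_inj); apply/setP => -[i j]; rewrite mem_invp !permE /=.
have [ij|ji] := ltnP i j; last by apply/esym/negP => /ltI; rewrite ltnNge ji.
apply/idP/idP => [|ijI /=]; last by apply: f_mono; rewrite /lt ltnNge ltnW.
rewrite ltnNge; apply: contraR => ijI; apply: ltnW; apply: f_mono.
by rewrite /lt ij.
Qed.

(* The only property of the nesting pairs [Xset B] that the order theory needs. *)
Definition left_initial X :=
  forall i j l, (i, l) \in X -> i < j -> j < l -> (i, j) \in X.

(** The transitive closure: [connect] is reflexive, and [ij.1 < ij.2] removes the diagonal, and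
    nothing else when [I] consists of increasing pairs. *)
Definition trcl I :=
  [set ij : 'I_k * 'I_k | (ij.1 < ij.2) && connect (fun i j => (i, j) \in I) ij.1 ij.2].

(** * Transitive closures and joins *)

Section TrCl.
Variable I : {set 'I_k * 'I_k}.
Hypothesis ltI : forall i j, (i, j) \in I -> i < j.
Let e i j := (i, j) \in I.

Lemma connect_leq i j : connect e i j -> i <= j.
Proof.
case/connectP=> p ep ->{j}; elim: p i ep => //= a p IHp i /andP[/ltI ia /IHp].
exact: leq_trans (ltnW ia).
Qed.

Lemma sub_trcl : I \subset trcl I.
Proof.
by apply/subsetP => -[i j] ij; rewrite inE (ltI ij); apply: connect1.
Qed.

(** A chain from [i] to [l] either visits the intermediate [j] or jumps over it in one link; the
    hypothesis splits that link at [j], which joins [j] to one end of the chain. *)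
Lemma biclosed_trcl :
  (forall i j l, (i, l) \in I -> i < j -> j < l -> (i, j) \in I \/ (j, l) \in I) ->
  biclosed (trcl I).
Proof.
move=> coI; split=> [i j|i j l|i j l]; rewrite !inE /=; first by case/andP.
  move=> /andP[ij cij] /andP[jl cjl].
  by rewrite (ltn_trans ij) //= (connect_trans cij).
case/andP=> _ + ij jl; rewrite ij jl /= => /connectP[p].
elim: p i ij => [|a p IHp] i ij /=; first by move=> _ eq_li; rewrite eq_li in jl; lia.
case/andP=> ia ap el; case: (ltngtP j a) => [ja|aj|/val_inj->].
- case: (coI _ _ _ ia ij ja) => [|ja']; first by left; apply: connect1.
  by right; apply: connect_trans (connect1 ja') _; apply/connectP; exists p.
- case: (IHp _ aj ap el) => [aj'|]; last by right.
  by left; apply: connect_trans (connect1 ia) aj'.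
- by left; apply: connect1.
Qed.

Lemma trcl_min J :
  (forall i j l, (i, j) \in J -> (j, l) \in J -> (i, l) \in J) ->
  I \subset J -> trcl I \subset J.
Proof.
move=> trJ /subsetP IJ; apply/subsetP => -[i j]; rewrite inE /=.
case/andP=> + /connectP[p]; elim: p i => [|a p IHp] i /=.
  by move=> + _ ej; rewrite ej ltnn.
move=> ij /andP[ia ap] ej; have {}ia := IJ _ ia.
have := IHp a _ ap ej; have : a <= j by apply: connect_leq; apply/connectP; exists p.
rewrite leq_eqVlt => /predU1P[/val_inj <- //|aj /(_ aj)]; exact: trJ ia.
Qed.
End TrCl.

Lemma trclU_left_initial X s t :
  left_initial X -> X :&: invp s = X :&: invp t ->
  X :&: trcl (invp s :|: invp t) = X :&: invp s.
Proof.
move=> liX eqX; set U := _ :|: _.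
have [ltS trS _] := biclosed_invp s; have [ltT trT _] := biclosed_invp t.
have ltU i j : (i, j) \in U -> i < j by case/setUP=> [/ltS|/ltT].
apply/setP => -[i j]; rewrite ![_ \in X :&: _]inE; case: ((i, j) \in X) / boolP => //= ijX.
apply/idP/idP => [|ijS]; last by apply: (subsetP (sub_trcl ltU)); rewrite inE ijS.
have memX l : (i, l) \in X -> ((i, l) \in invp s) = ((i, l) \in invp t).
  by move=> ilX; have /setP/(_ (i, l)) := eqX; rewrite !inE ilX.
rewrite inE /= => /andP[ij /connectP[p]].
(* Invariant along the chain: the current point is [i] or is inverted with [i] by both permutations.
   At the next point [b], transitivity in whichever permutation inverts [(a, b)] yields [(i, b)];
   this pair is in [X], where both agree. *)
suff H a : a = i \/ (i, a) \in invp s /\ (i, a) \in invp t ->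
    path (fun i j => (i, j) \in U) a p -> j = last a p -> (i, j) \in invp s.
  by apply: H; left.
elim: p a => [|b p IHp] a Pa /=.
  by move=> _ ej; rewrite -ej in Pa; case: Pa => [eij|[]//]; rewrite eij ltnn in ij.
case/andP=> abU bp ej; apply: (IHp b) => //; right.
have le_bj : b <= j by apply: (connect_leq ltU); apply/connectP; exists p.
have le_ia : i <= a by case: Pa => [->//|[/ltS/ltnW]].
have ibX : (i, b) \in X.
  move: le_bj; rewrite leq_eqVlt => /predU1P[/val_inj ->//|]; apply: liX ijX _.
  exact: leq_ltn_trans (ltU _ _ abU).
suff : (i, b) \in U by rewrite inE (memX _ ibX) orbb; split.
case: Pa => [<-//|[iaS iaT]]; rewrite inE.
by case/setUP: abU => [/(trS _ _ _ iaS)->//|/(trT _ _ _ iaT)->]; rewrite orbT.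
Qed.

(** A union of co-closed sets is co-closed, so its transitive closure is biclosed, and it is least
    because inversion sets are transitive. The trace claim concerns the same witness; uniqueness of
    joins carries it to [wjoin]. *)
Lemma weak_is_join_exists s t : exists m, weak_is_join s t m /\
  forall X, left_initial X -> X :&: invp s = X :&: invp t -> X :&: invp m = X :&: invp s.
Proof.
have [ltS trS coS] := biclosed_invp s; have [ltT trT coT] := biclosed_invp t.
pose U := invp s :|: invp t.
have ltU i j : (i, j) \in U -> i < j by case/setUP=> [/ltS|/ltT].
have [|m invm] := @invp_surj (trcl U).
  apply: biclosed_trcl => // i j l /setUP[/coS|/coT] H /H{}H /H; rewrite !inE.
    by case=> ->; [left | right].
  by case=> ->; rewrite orbT; [left | right].
exists m; split; last by move=> X liX eqX; rewrite invm trclU_left_initial.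
have := sub_trcl ltU; rewrite -invm subUset => /andP[sm tm].
apply/and3P; split=> //; apply/forallP => x; apply/implyP => sx; apply/implyP => tx.
rewrite /weak_le invm; apply: trcl_min => //; last by rewrite subUset; apply/andP.
by case: (biclosed_invp x).
Qed.

Lemma weak_is_join_uniq s t m m' : weak_is_join s t m -> weak_is_join s t m' -> m = m'.
Proof.
case/and3P=> sm tm /forallP minm /and3P[sm' tm' /forallP minm'].
have := minm m'; rewrite sm' tm' /=; have := minm' m; rewrite sm tm /=.
by move=> m'm mm'; apply: weak_le_anti.
Qed.

(** Since a join exists, the default value in [wjoin] is never returned. *)
Lemma wjoinP s t : weak_is_join s t (wjoin s t).
Proof.
rewrite /wjoin; case: pickP => //= nom.
by have [m [sm _]] := weak_is_join_exists s t; rewrite nom in sm.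
Qed.

Lemma wjoin_left_initial X s t :
  left_initial X -> X :&: invp s = X :&: invp t -> X :&: invp (wjoin s t) = X :&: invp s.
Proof.
have [m [sm clX]] := weak_is_join_exists s t.
by rewrite (weak_is_join_uniq (wjoinP s t) sm); apply: clX.
Qed.

(** * Reversal of the values and meets *)

Definition revp s : {perm 'I_k} := (s * perm (@rev_ord_inj k))%g.

Lemma revpE s i : revp s i = rev_ord (s i).
Proof. by rewrite permM permE. Qed.

Lemma revpK : involutive revp.
Proof. by move=> s; apply/permP => i; rewrite !revpE rev_ordK. Qed.

Lemma mem_invp_revp s i j : ((i, j) \in invp (revp s)) = (i < j) && ((i, j) \notin invp s).
Proof.
rewrite !mem_invp !revpE /=; case: (ltnP i j) => //= lt_ij.
have := @perm_neq_ltn s i j; rewrite neq_ltn lt_ij => /(_ isT).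
have := ltn_ord (s i); have := ltn_ord (s j); lia.
Qed.

Lemma weak_le_revp s t : weak_le (revp s) (revp t) = weak_le t s.
Proof.
have le_rev s' t' : weak_le t' s' -> weak_le (revp s') (revp t').
  move=> /weak_leP ts; apply/weak_leP => i j; rewrite !mem_invp_revp.
  by case: (i < j) => //=; apply: contra; apply: ts.
by apply/idP/idP => /le_rev //; rewrite !revpK.
Qed.

Lemma revp_class X s t :
  X :&: invp s = X :&: invp t -> X :&: invp (revp s) = X :&: invp (revp t).
Proof.
move=> /setP eqX; apply/setP => -[i j]; move: {eqX}(eqX (i, j)).
by rewrite ![_ \in X :&: _]inE !mem_invp_revp; case: (_ \in X) => //= ->.
Qed.

(** Reversing the values complements inversion sets among increasing pairs, hence reverses the weak
    order. *)
Lemma weak_is_meet_revp s t m :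
  weak_is_meet s t m = weak_is_join (revp s) (revp t) (revp m).
Proof.
rewrite /weak_is_meet /weak_is_join !weak_le_revp; congr [&& _, _ & _].
apply/forallP/forallP => H x; first by rewrite -[x]revpK !weak_le_revp; apply: H.
by have := H (revp x); rewrite !weak_le_revp.
Qed.

Lemma wmeetE s t : wmeet s t = revp (wjoin (revp s) (revp t)).
Proof.
have meetJ : weak_is_meet s t (revp (wjoin (revp s) (revp t))).
  by rewrite weak_is_meet_revp revpK wjoinP.
rewrite /wmeet; case: pickP => [m|/(_ (revp (wjoin (revp s) (revp t))))]; last by rewrite meetJ.
rewrite weak_is_meet_revp => mJ /=; rewrite -[LHS]revpK; congr revp.
exact: weak_is_join_uniq mJ (wjoinP _ _).
Qed.

Lemma wmeetP s t : weak_is_meet s t (wmeet s t).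
Proof. by rewrite weak_is_meet_revp wmeetE revpK wjoinP. Qed.

Lemma wmeet_left_initial X s t :
  left_initial X -> X :&: invp s = X :&: invp t -> X :&: invp (wmeet s t) = X :&: invp s.
Proof.
move=> liX /revp_class eqX; rewrite wmeetE -[s in RHS]revpK; apply: revp_class.
exact: wjoin_left_initial.
Qed.

(** The ends are members with the most and the fewest inversions: joins and meets stay in the class,
    so counting makes these ends its greatest and least elements. Conversely, the trace of anything
    between them is squeezed between equal sets. *)
Lemma class_interval X s0 : left_initial X ->
  exists s t, [/\ weak_le s t, X :&: invp s = X :&: invp s0, X :&: invp t = X :&: invp s0
    & forall r, weak_le s r && weak_le r t = (X :&: invp r == X :&: invp s0)].
Proof.
move=> liX; pose P r := X :&: invp r == X :&: invp s0.
have [t /eqP Pt maxt] := @arg_maxnP _ s0 P (fun r => #|invp r|) (eqxx _).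
have [s /eqP Ps mins] := @arg_minnP _ s0 P (fun r => #|invp r|) (eqxx _).
have le_t r : P r -> weak_le r t.
  move=> /eqP Pr; have /and3P[rj tj _] := wjoinP r t.
  have/eqP Pj : X :&: invp (wjoin r t) = X :&: invp s0.
    by rewrite wjoin_left_initial ?Pr.
  suff /invp_inj -> : invp t = invp (wjoin r t) by [].
  by apply/eqP; rewrite eqEcard; apply/andP; split; [exact: tj | exact: maxt].
have ge_s r : P r -> weak_le s r.
  move=> /eqP Pr; have /and3P[jr js _] := wmeetP r s.
  have/eqP Pj : X :&: invp (wmeet r s) = X :&: invp s0.
    by rewrite wmeet_left_initial ?Pr.
  suff /invp_inj <- : invp (wmeet r s) = invp s by [].
  by apply/eqP; rewrite eqEcard; apply/andP; split; [exact: js | exact: mins].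
exists s, t; split=> //; first by apply: le_t; apply/eqP.
move=> r; apply/andP/idP => [[sr rt]|Pr]; last by split; [apply: ge_s | apply: le_t].
by rewrite eqEsubset -{1}Pt -Ps !setIS.
Qed.

(* The witness is a pair of [invp t :\: invp s] with [s j - s i] minimal. *)
Lemma weak_lt_adjacent s t : weak_le s t -> s != t ->
  exists i j, [/\ i < j, (i, j) \in invp t & s j = (s i).+1 :> nat].
Proof.
move=> /subsetP le_st neq_st.
have /set0Pn[ij0 ij0D] : invp t :\: invp s != set0.
  apply: contra neq_st; rewrite setD_eq0 => ts.
  by apply/eqP/weak_le_anti => //; apply/subsetP.
have [[i j] /= + mind] := @arg_minnP _ ij0 (mem (invp t :\: invp s))
  (fun ij => s ij.2 - s ij.1) ij0D.
rewrite inE /= => /andP[ijNs ijt]; have := ijt; rewrite mem_invp => /andP[ij tij].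
have sij : s i < s j.
  have := @perm_neq_ltn s i j; rewrite neq_ltn ij => /(_ isT) /orP[]// sji.
  by rewrite mem_invp ij sji in ijNs.
exists i, j; split=> //; apply/eqP; rewrite eqn_leq sij andbT leqNgt; apply/negP => gap.
have lt_k : (s i).+1 < k by apply: ltn_trans gap _.
(* If the two values are not adjacent, [l] holds the one just above [s i]. Its gaps to [i] and [j]
   are smaller, so by minimality [t] keeps both comparisons and [t i < t l < t j] contradicts
   [tij]. *)
pose l := (s^-1)%g (Ordinal lt_k).
have sl : s l = (s i).+1 :> nat by rewrite permKV.
have gap1 a b : s a < s b -> s b - s a < s j - s i -> a < b -> t a < t b.
  move=> sab lt_gap ab; have := @perm_neq_ltn t a b; rewrite neq_ltn ab => /(_ isT).
  case/orP=> // tba; have := mind (a, b) => /= mab.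
  have: s j - s i <= s b - s a by apply: mab; rewrite inE !mem_invp ab /= -leqNgt ltnW.
  by rewrite leqNgt lt_gap.
have gap2 a b : s a < s b -> b < a -> t a < t b.
  move=> sab ba; have := le_st (b, a); rewrite !mem_invp ba sab.
  by move=> /(_ isT).
have gapT a b : s a < s b -> s b - s a < s j - s i -> t a < t b.
  move=> sab lt_gap; case: (ltngtP a b) => [ab|ba|/val_inj eab].
  - exact: gap1.
  - exact: gap2.
  - by rewrite eab ltnn in sab.
have til : t i < t l by apply: gapT; lia.
have tlj : t l < t j by apply: gapT; lia.
lia.
Qed.

(** No value lies strictly between [s i] and [s j], so exchanging them affects the comparison of no
    other pair. *)
Lemma invp_mul_tperm s i j : i < j -> s j = (s i).+1 :> nat ->
  invp (s * tperm (s i) (s j))%g = (i, j) |: invp s.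
Proof.
move=> ij sij; apply/setP => -[a b]; rewrite in_setU1 !mem_invp !permM xpair_eqE.
have eqs x y : (x == y) = (val (s x) == val (s y)) by rewrite val_eqE (inj_eq perm_inj).
have vt x : val (tperm (s i) (s j) (s x)) =
    if val (s x) == val (s i) then val (s j) else if val (s x) == val (s j) then val (s i) else val (s x).
  rewrite !val_eqE; case: tpermP => [->|->|/eqP/negPf-> /eqP/negPf->] //; rewrite ?eqxx //.
  by case: eqP => [/perm_inj e|//]; rewrite e ltnn in ij.
have eqi x y : (x == y) = (val x == val y) by rewrite val_eqE.
have ha := vt a; have hb := vt b; rewrite /= in ha hb; rewrite ha hb.
have ai := eqs a i; have bj := eqs b j; have aj := eqs a j; have bi := eqs b i.
rewrite !eqi /= in ai bj aj bi *.
move: (nat_of_ord (s a)) (nat_of_ord (s b)) (nat_of_ord (s i)) (nat_of_ord (s j)) sij ai bj aj bi.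
move=> sa sb si sj -> ai bj aj bi; rewrite ai bj; move: ai bj aj bi.
case: (ltngtP sa si); case: (ltngtP sb si.+1); case: (ltngtP sb si); case: (ltngtP sa si.+1); lia.
Qed.

End WeakOrder.

(** * Blocks of a set partition and packed words *)


Lemma minb_leq n (C : {set 'I_n}) (p : 'I_n) : p \in C -> minb C <= p.
Proof.
move=> pC; rewrite /minb; have: p \in index_enum 'I_n by rewrite mem_index_enum.
elim: (index_enum _) => //= q r IHr; rewrite inE big_cons.
case/predU1P=> [<-|/IHr le_p]; first by rewrite pC geq_minl.
by case: ifP => // _; rewrite geq_min le_p orbT.
Qed.

Lemma minb_eq n (C : {set 'I_n}) (p : 'I_n) :
  p \in C -> (forall q, q \in C -> p <= q) -> minb C = p.
Proof.
move=> pC minp; apply/eqP; rewrite eqn_leq minb_leq //= /minb.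
(* The first case is the default [n] of the minimum, which exceeds every position. *)
elim/big_ind: _ => [|a b pa pb|q /minp//]; first exact: ltnW.
by rewrite leq_min pa.
Qed.

Section Partition.
Variables (n : nat) (B : {set {set 'I_n}}).
Hypothesis partB : partition B [set: 'I_n].
Implicit Types (p q : 'I_n) (i j l : 'I_#|B|).

Lemma trivB : trivIset B. Proof. by case/and3P: partB. Qed.

Lemma mem_pblockT p : p \in pblock B p.
Proof. by case/and3P: partB => /eqP coverB _ _; rewrite mem_pblock coverB inE. Qed.

Lemma pblock_memT p : pblock B p \in B.
Proof. by apply: pblock_mem; rewrite -mem_pblock mem_pblockT. Qed.

Lemma leaderP p : reflect (forall q, q \in pblock B p -> p <= q) (p \in leaders B).
Proof. by rewrite mem_filter mem_enum andbT; apply: forall_inP. Qed.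

Lemma uniq_blocks : uniq (blocks B).
Proof.
rewrite map_inj_in_uniq; first exact/filter_uniq/enum_uniq.
move=> p q /leaderP minp /leaderP minq eqpq.
by apply/val_inj/anti_leq; rewrite minp ?minq // ?eqpq ?mem_pblockT // -eqpq mem_pblockT.
Qed.

Lemma mem_blocks : blocks B =i B.
Proof.
move=> C; apply/mapP/idP => [[p _ ->]|CB]; first exact: pblock_memT.
have /set0Pn[p0 p0C] : C != set0.
  by case/and3P: partB => _ _ nB0; apply: contraNneq nB0 => <-.
have [p pC minp] := @arg_minnP _ p0 (mem C) (fun q => q) p0C.
have pbC : pblock B p = C by apply: def_pblock trivB CB pC.
by exists p => //; apply/leaderP; rewrite pbC.
Qed.

Lemma size_blocks : size (blocks B) = #|B|.
Proof. by rewrite -(card_uniqP uniq_blocks); apply: eq_card mem_blocks. Qed.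

Fact bidx_subproof p : index (pblock B p) (blocks B) < #|B|.
Proof. by rewrite -size_blocks index_mem mem_blocks pblock_memT. Qed.
Definition bidx p : 'I_#|B| := Ordinal (bidx_subproof p).

Lemma blk_bidx p : blk B (bidx p) = pblock B p.
Proof. by rewrite /blk nth_index // mem_blocks pblock_memT. Qed.

Lemma mem_blk i q : (q \in blk B i) = (bidx q == i).
Proof.
apply/idP/eqP => [qi|<-]; last by rewrite blk_bidx mem_pblockT.
have iB : blk B i \in B by rewrite -mem_blocks mem_nth ?size_blocks.
by apply: val_inj; rewrite /= (def_pblock trivB iB qi) index_uniq ?size_blocks ?uniq_blocks.
Qed.

Lemma minb_blkP i : exists p,
  [/\ bidx p = i, minb (blk B i) = p & nth p (leaders B) i = p].
Proof.
have ltil : i < size (leaders B) by rewrite -(size_map (pblock B)) size_blocks.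
have [x0 _] : exists x0, x0 \in leaders B.
  by case: (leaders B) ltil => // x0 r _; exists x0; rewrite mem_head.
set p := nth x0 (leaders B) i.
have lp : p \in leaders B by rewrite mem_nth.
have blkE : blk B i = pblock B p by rewrite /blk (nth_map x0).
have pi : bidx p = i by apply/eqP; rewrite -mem_blk blkE mem_pblockT.
exists p; split=> //; last by rewrite (set_nth_default x0).
by rewrite blkE; apply: minb_eq (mem_pblockT _) (leaderP _ lp).
Qed.

Lemma minb_blk_leq p : minb (blk B (bidx p)) <= p.
Proof. by apply: minb_leq; rewrite mem_blk. Qed.

(** Blocks are listed by their leaders, which are their minima and form a filtered increasing
    enumeration. *)
Lemma minb_blk_ltn i j : (minb (blk B i) < minb (blk B j)) = (i < j).
Proof.
have homo (a b : 'I_#|B|) : a < b -> minb (blk B a) < minb (blk B b).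
  have [p [_ -> pa]] := minb_blkP a; have [q [_ -> qb]] := minb_blkP b.
  have ltl (x : 'I_#|B|) : x < size (leaders B).
    by rewrite -(size_map (pblock B)) size_blocks.
  have: sorted (relpre val ltn) (leaders B).
    apply: sorted_filter; first by move=> ? ? ?; apply: ltn_trans.
    by rewrite -sorted_map val_enum_ord iota_ltn_sorted.
  move=> sorted_l ab; rewrite -{}pa -{}qb (set_nth_default p q) ?ltl //.
  by apply: (sorted_ltn_nth _ p sorted_l); rewrite ?inE ?ltl // => ? ? ?; apply: ltn_trans.
by case: (ltngtP i j) => [/homo|/homo/ltnW|/val_inj->]; rewrite ?ltnn // ltnNge => ->.
Qed.

Lemma XsetP i j :
  reflect (i < j /\ exists2 p, bidx p = i & minb (blk B j) < p) ((i, j) \in Xset B).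
Proof.
rewrite inE /nested /= minb_blk_ltn andbA andbb.
apply: (iffP andP) => [] [ij H]; split=> //.
  have [x [xi _ _]] := minb_blkP i.
  have [|p pi maxp] := @eq_bigmax_cond _ (mem (blk B i)) (@nat_of_ord n).
    by apply/card_gt0P; exists x; rewrite /= mem_blk xi.
  by exists p; [apply/eqP; rewrite -mem_blk | rewrite -maxp].
case: H => p pi /leq_trans; apply; rewrite /maxb.
by apply: (@leq_bigmax_cond _ _ (@nat_of_ord n)); rewrite mem_blk pi.
Qed.

(** Turns non-nestedness into the condition on positions that [iInv] imposes: one block lies
    entirely before the other. *)
Lemma notin_XsetP i j : i < j ->
  reflect (forall p q, bidx p = i -> bidx q = j -> p < q) ((i, j) \notin Xset B).
Proof.
move=> ij; apply: (iffP idP) => [nX p q' pi q'j | lt_ij];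
  have [q [qj minq _]] := minb_blkP j.
  rewrite ltnNge; apply: contra nX => q'p; apply/XsetP; split=> //; exists p => //.
  have: minb (blk B j) <= p by rewrite -q'j; apply: leq_trans (minb_blk_leq q') q'p.
  rewrite leq_eqVlt => /predU1P[|//]; rewrite minq => /val_inj eqp.
  by rewrite -pi -eqp qj ltnn in ij.
apply/XsetP => -[_ [p pi]]; rewrite minq ltnNge => /negP; apply.
by apply: ltnW; apply: lt_ij.
Qed.

(** An element of block [i] beyond the minimum of block [l] is also beyond the smaller minimum of
    block [j]. *)
Lemma left_initial_Xset : left_initial (Xset B).
Proof.
move=> i j l /XsetP[_ [p pi lp]] ij jl; apply/XsetP; split=> //; exists p => //.
by apply: ltn_trans lp; rewrite minb_blk_ltn.
Qed.

(** * Packed words with a given set partition *)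

Implicit Types s t : {perm 'I_#|B|}.

Lemma tnth_pw s p : tnth (pw B s) p = (s (bidx p)).+1.
Proof.
rewrite tnth_mktuple -[index _ _]/(bidx p : nat) (nth_map (bidx p)) ?size_enum_ord //.
by rewrite nth_ord_enum.
Qed.

Lemma mem_pw s b : reflect (exists i, b = (s i).+1) (b \in (pw B s : seq nat)).
Proof.
apply: (iffP (tnthP _ _)) => [[p ->]|[i ->]]; first by exists (bidx p); rewrite tnth_pw.
by have [p [pi _ _]] := minb_blkP i; exists p; rewrite tnth_pw pi.
Qed.

Lemma lead_letterE (w : n.-tuple nat) i :
  exists2 p, bidx p = i & lead_letter B w i = tnth w p.
Proof.
have [p [pi minp _]] := minb_blkP i; exists p => //.
by rewrite /lead_letter minp (tnth_nth 0).
Qed.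

Lemma lead_letter_pw s i : lead_letter B (pw B s) i = (s i).+1.
Proof. by have [p <- ->] := lead_letterE (pw B s) i; rewrite tnth_pw. Qed.

Lemma InvW_pw s : InvW B (pw B s) = invp s.
Proof. by apply/setP => ij; rewrite !inE !lead_letter_pw ltnS. Qed.

(** Leading letters minus one are in range and form a permutation, so neither default of [insubd] is
    reached. *)
Lemma delrpt_pw s : delrpt B (pw B s) = s.
Proof.
suff -> : delrpt B (pw B s) = insubd (1%g : {perm 'I_#|B|}) (val s) by rewrite valKd.
congr insubd; apply/ffunP => i; rewrite ffunE lead_letter_pw /= pvalE.
exact: valKd.
Qed.

Lemma packed_pw s : packed (pw B s).
Proof.
apply/andP; split; first by apply/mem_pw => -[].
apply/allP => -[|b]; rewrite mem_iota // add1n !ltnS => lt_b.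
have ltbk : b < #|B|.
  apply: leq_trans lt_b _; rewrite /maxletter; apply/bigmax_leqP_seq => x /mem_pw[i ->] _.
  exact: ltn_ord.
by apply/mem_pw; exists (s^-1 (Ordinal ltbk))%g; rewrite permKV.
Qed.

Lemma setpar_pw s : setpar (pw B s) = B.
Proof.
have memE p : [set q | tnth (pw B s) q == tnth (pw B s) p] = pblock B p.
  apply/setP => q; rewrite inE !tnth_pw eqSS val_eqE (inj_eq perm_inj) -blk_bidx.
  by rewrite mem_blk.
apply/setP => C; apply/imsetP/idP => [[p _ ->]|CB]; first by rewrite memE pblock_memT.
have := CB; rewrite -mem_blocks => /mapP[p _ ->]; exists p => //.
Qed.

(** Letters agree exactly within blocks, so [w] amounts to one letter per block; packedness makes
    these distinct letters exactly [1] to [#|B|]. *)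
Lemma pw_surj (w : n.-tuple nat) :
  packed w -> setpar w = B -> exists s, w = pw B s.
Proof.
move=> /andP[w0 /allP wpack] wB; pose f i := lead_letter B w i.
have eqw p q : (tnth w p == tnth w q) = (bidx p == bidx q).
  rewrite -mem_blk blk_bidx.
  rewrite (@def_pblock _ _ [set r | tnth w r == tnth w q]) ?inE ?trivB //.
  by rewrite -{1}wB; apply: imset_f.
have wE p : tnth w p = f (bidx p).
  by rewrite /f; have [q /eqP qp ->] := lead_letterE w (bidx p); apply/eqP; rewrite eqw eq_sym.
have f_inj : injective f.
  move=> i j; rewrite /f; have [p <- ->] := lead_letterE w i.
  by have [q <- ->] := lead_letterE w j => /eqP; rewrite eqw => /eqP.
have f_w i : f i \in w by rewrite /f; have [p _ ->] := lead_letterE w i; apply: mem_tnth.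
have f_gt0 i : 0 < f i by rewrite lt0n; apply: contraNneq w0 => <-.
have le_f i : f i <= maxletter w by exact: (@leq_bigmax_seq _ w xpredT id).
have uniq_f : uniq (codom f) by rewrite map_inj_uniq ?enum_uniq.
have eq_f : codom f =i iota 1 (maxletter w).
  move=> x; apply/codomP/idP => [[i ->]|/wpack/tnthP[p ->]].
    by rewrite mem_iota f_gt0 add1n ltnS le_f.
  by exists (bidx p).
have maxE : maxletter w = #|B|.
  rewrite -(size_iota 1 (maxletter w)) -(perm_size (uniq_perm uniq_f (iota_uniq _ _) eq_f)).
  by rewrite size_codom card_ord.
have lt_f i : (f i).-1 < #|B| by rewrite prednK // -maxE.
have g_inj : injective (fun i => Ordinal (lt_f i)).
  by move=> i j [] /(congr1 S); rewrite !prednK // => /f_inj.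
exists (perm g_inj); apply: eq_from_tnth => p.
by rewrite tnth_pw permE /= prednK // wE.
Qed.

End Partition.

Lemma partition_setpar n (w : n.-tuple nat) : partition (setpar w) [set: 'I_n].
Proof.
suff -> : setpar w = preim_partition (tnth w) [set: 'I_n] by apply: preim_partitionP.
apply/setP => C; apply/imsetP/imsetP => -[p _ ->]; exists p => //;
  by apply/setP => q; rewrite !inE eq_sym.
Qed.

Lemma maxpos_lt_minposP n (w : n.-tuple nat) a b : a \in w -> b \in w ->
  reflect (forall p q, tnth w p = b -> tnth w q = a -> p < q) (maxpos b w < minpos a w).
Proof.
move=> aw bw.
have ltm : minpos a w < n by rewrite -[X in _ < X](size_tuple w) index_mem.
have ltM : maxpos b w < n.
  by rewrite /maxpos size_tuple; case: n w aw bw ltm => // n w *; rewrite ltnS leq_subr.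
have bwr : index b (rev w) < n.
  by rewrite -[X in _ < X](size_tuple w) -size_rev index_mem mem_rev.
apply: (iffP idP) => [lt_ba p q pb qa | H].
  have le_q : minpos a w <= q.
    by rewrite -qa (tnth_nth 0); apply: index_nth; rewrite size_tuple.
  have le_p : p <= maxpos b w.
    have lt_p : n - p.+1 < n by have := ltn_ord p; lia.
    (* Position [p] becomes [n - p.+1] in the reversed word, which bounds the index of [b] there. *)
    have eb : nth 0 (rev w) (n - p.+1) = b.
      rewrite nth_rev ?size_tuple // -pb (tnth_nth 0); congr nth.
      by have := ltn_ord p; lia.
    have: index b (rev w) <= n - p.+1.
      by rewrite -[X in index X]eb; apply: index_nth; rewrite size_rev size_tuple.
    by rewrite /maxpos size_tuple; have := ltn_ord p; lia.
  exact: leq_ltn_trans le_p (leq_trans lt_ba le_q).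
apply: (H (Ordinal ltM) (Ordinal ltm)); rewrite (tnth_nth 0) /=; last first.
  by rewrite nth_index.
rewrite /maxpos size_tuple.
have: nth 0 (rev w) (index b (rev w)) = b by rewrite nth_index ?mem_rev.
rewrite nth_rev ?size_tuple // => {2}<-; congr nth; lia.
Qed.

Local Arguments pw {n} B s : simpl never.

(** * Covers and components *)

Section Order.
Variables (n : nat) (B : {set {set 'I_n}}).
Hypothesis partB : partition B [set: 'I_n].
Implicit Types (i j l : 'I_#|B|) (s t : {perm 'I_#|B|}) (u w : n.-tuple nat).
Implicit Types A : {set 'I_#|B| * 'I_#|B|}.

(** [f] turns a pair of blocks into its letters in the opposite order, since the later block of an
    inversion carries the smaller letter. The position condition of [iInv] removes the nested
    pairs. *)
Lemma size_iInv_pw s : size (iInv (pw B s)) = #|invp s :\: Xset B|.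
Proof.
pose f (ij : 'I_#|B| * 'I_#|B|) := ((s ij.2).+1, (s ij.1).+1).
rewrite cardE -(size_map f); apply: perm_size; apply: uniq_perm.
- by apply/filter_uniq/allpairs_uniq; rewrite ?undup_uniq // => -[? ?] [].
- rewrite map_inj_uniq ?enum_uniq // => -[i j] [i' j'] [].
  by move=> /val_inj/perm_inj-> /val_inj/perm_inj->.
move=> [a b]; rewrite mem_filter /=; apply/andP/mapP.
  case=> /andP[ab lt_pos] /allpairsP[[a' b'] /= [+ + [ea eb]]].
  rewrite -{a'}ea -{b'}eb !mem_undup => aw bw.
  have {}lt_pos := @maxpos_lt_minposP _ (pw B s) _ _ aw bw lt_pos.
  have [j ea] := mem_pw partB _ _ aw; have [i eb] := mem_pw partB _ _ bw.
  have lt_ij p q : bidx partB p = i -> bidx partB q = j -> p < q.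
    by move=> pi qj; apply: lt_pos; rewrite (tnth_pw partB) ?pi ?qj.
  have ij : i < j.
    have [p [pi mp _]] := minb_blkP partB i; have [q [qj mq _]] := minb_blkP partB j.
    by rewrite -(minb_blk_ltn partB) mp mq lt_ij.
  exists (i, j); last by rewrite /f /= -ea -eb.
  rewrite mem_enum in_setD mem_invp ij -[s j < s i]ltnS -ea -eb ab !andbT.
  exact/(notin_XsetP partB ij).
case=> -[i j]; rewrite mem_enum in_setD mem_invp => /and3P[nX ij sji] [-> ->] /=.
have jw : (s j).+1 \in (pw B s : seq nat) by apply/(mem_pw partB _ _); exists j.
have iw : (s i).+1 \in (pw B s : seq nat) by apply/(mem_pw partB _ _); exists i.
split; last by apply: allpairs_f; rewrite mem_undup.
rewrite ltnS sji; apply/(maxpos_lt_minposP jw iw) => p q.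
rewrite !(tnth_pw partB) => -[/val_inj/perm_inj pi] [/val_inj/perm_inj qj].
exact: (notin_XsetP partB ij) pi qj.
Qed.

Lemma tnth_Ta a (w : n.-tuple nat) p : tnth (Ta a w) p = swapl a (tnth w p).
Proof. exact: tnth_map. Qed.

Lemma swapl_invol a : involutive (swapl a).
Proof.
move=> x; rewrite /swapl; case: (x =P a) => [->|/eqP/negPf xa].
  by rewrite eqxx; case: eqP.
by case: (x =P a.+1) => [->|/eqP/negPf xSa]; rewrite ?eqxx ?xa ?xSa.
Qed.

Lemma swapl_ltn a x y : x < y -> swapl a y < swapl a x -> x = a /\ y = a.+1.
Proof. by rewrite /swapl; do ![case: eqP => ?]; lia. Qed.

(* The length condition forces the two blocks exchanged by [Ta a] to be
   non-nested. *)
Lemma covers_pw_weak_le s t : covers (pw B s) (pw B t) ->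
  weak_le s t /\ Xset B :&: invp s = Xset B :&: invp t.
Proof.
case=> _ [_ [[a sTt] szE]]; rewrite !size_iInv_pw in szE.
have sE i : (s i).+1 = swapl a (t i).+1.
  have [p [<- _ _]] := minb_blkP partB i.
  by rewrite -!tnth_pw sTt tnth_Ta.
have swapped i j : (s i < s j) -> (t j < t i) -> (t j).+1 = a /\ (t i).+1 = a.+1.
  by move=> sij tji; apply: swapl_ltn; rewrite -?sE.
have diff i j : (i, j) \in invp t -> (i, j) \notin invp s -> (t j).+1 = a /\ (t i).+1 = a.+1.
  rewrite !mem_invp => /andP[ij tji]; rewrite ij /= => nsji; apply: swapped => //.
  have := @perm_neq_ltn _ s i j; rewrite neq_ltn ij (negPf nsji) orbF.
  exact.
(* By cardinality [t] has a non-nested inversion missing from [s]; by [diff] its letters are [a] and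
   [a.+1]. *)
have [i [j [ijt ijs ijX]]] : exists i j,
    [/\ (i, j) \in invp t, (i, j) \notin invp s & (i, j) \notin Xset B].
  have: ~~ (invp t :\: Xset B \subset invp s :\: Xset B).
    by apply/negP => /subset_leq_card; rewrite szE ltnn.
  case/subsetPn=> -[i j]; rewrite !in_setD => /andP[nX ijt]; rewrite nX /= => ijs.
  by exists i, j.
have [tj ti] := diff _ _ ijt ijs.
(* A lost inversion would involve the same two blocks in the opposite order, against [i < j]. *)
have le_st : weak_le s t.
  apply/weak_leP => i' j'; rewrite !mem_invp => /andP[ij' sji']; rewrite ij' /=.
  rewrite ltnNge leq_eqVlt negb_or -leqNgt.
  apply/andP; split.
    by apply: contraTneq ij' => /val_inj/perm_inj->; rewrite ltnn.
  rewrite leqNgt; apply/negP => tij'; have [ti' tj'] := swapped _ _ sji' tij'.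
  have ei : i' = j by apply/(@perm_inj _ t)/val_inj/succn_inj; rewrite ti' tj.
  have ej : j' = i by apply/(@perm_inj _ t)/val_inj/succn_inj; rewrite tj' ti.
  by move: ijt ij'; rewrite mem_invp ei ej; case: ltngtP.
(* A new inversion inside [Xset B] would be the pair [(i, j)] itself, which lies outside. *)
split=> //; apply/eqP; rewrite eqEsubset setIS //=.
apply/subsetP => -[i' j']; rewrite !in_setI => /andP[ijX' ijt']; rewrite ijX' /=.
apply/negPn/negP => ijs'; have [tj' ti'] := diff _ _ ijt' ijs'.
have ei : i' = i by apply/(@perm_inj _ t)/val_inj/succn_inj; rewrite ti' ti.
have ej : j' = j by apply/(@perm_inj _ t)/val_inj/succn_inj; rewrite tj' tj.
by rewrite -ei -ej ijX' in ijX.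
Qed.

Lemma covers_pw_tperm s i j : i < j -> (i, j) \notin Xset B -> s j = (s i).+1 :> nat ->
  covers (pw B s) (pw B (s * tperm (s i) (s j))%g).
Proof.
move=> ij nX sij; do 2?[split; first exact: packed_pw]; split; last first.
  rewrite !size_iInv_pw invp_mul_tperm // setDUl.
  rewrite (setDidPl _) ?disjoints1 // cardsU1 in_setD mem_invp ij sij.
  by rewrite ltnNge leqnSn andbF.
(* Letters are values plus one, so exchanging [s i] and its successor is [Ta] at [(s i).+1]. *)
exists (s i).+1; apply: eq_from_tnth => p; rewrite tnth_Ta !tnth_pw // permM.
move: (bidx partB p) => l.
rewrite /swapl !eqSS -sij.
case: tpermP => [->|->|/eqP ni /eqP nj].
- by rewrite !sij eqxx eqn_leq ltnn.
- by rewrite eqxx.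
- by rewrite (negPf (ni : val _ != val _)) (negPf (nj : val _ != val _)).
Qed.

(** Induction on the number of inversions of [t] missing from [s]: an adjacent exchange adds one of
    them, outside [Xset B] because the traces agree. *)
Lemma weak_le_pwle s t : weak_le s t -> Xset B :&: invp s = Xset B :&: invp t ->
  pwle (pw B s) (pw B t).
Proof.
have [m] := ubnP #|invp t :\: invp s|; elim: m s => // m IHm s.
rewrite ltnS => ltm le_st eqX; have [->|neq_st] := eqVneq s t; first exact: rt_refl.
have [i [j [ij ijt sij]]] := weak_lt_adjacent le_st neq_st.
have ijs : (i, j) \notin invp s by rewrite mem_invp ij sij ltnNge leqnSn.
have ijX : (i, j) \notin Xset B.
  apply: contra ijs => ijX; have /setP/(_ (i, j)) := eqX.
  by rewrite !in_setI ijX ijt !andTb => ->.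
apply: rt_trans (rt_step _ _ _ _ (covers_pw_tperm ij ijX sij)) _.
apply: IHm; rewrite /weak_le ?invp_mul_tperm //.
- apply: leq_trans ltm; apply: proper_card; apply/properP; split.
    by apply: setDS; apply: subsetUr.
  by exists (i, j); rewrite in_setD ?setU11 // ijs ijt.
- by rewrite subUset sub1set ijt.
- rewrite setIUr -eqX; apply/setUidPr/subsetP => ij'.
  by rewrite in_setI in_set1 => /andP[+ /eqP e]; rewrite e (negPf ijX).
Qed.

(** * Connected components *)

Lemma covers_setpar (u w : n.-tuple nat) : covers u w -> setpar u = setpar w.
Proof.
case=> _ [_ [[a ->] _]]; apply/setP => C.
apply/imsetP/imsetP => -[p _ ->]; exists p => //; apply/setP => q;
  by rewrite !inE !tnth_Ta (inj_eq (inv_inj (swapl_invol a))).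
Qed.

Lemma inWA_pw A s : A \subset Xset B ->
  inWA B A (pw B s) <-> Xset B :&: invp s = A.
Proof.
move=> AX; rewrite /inWA InvW_pw //; split=> [[_ [_ [AI XAI]]]|eqA].
  apply/eqP; rewrite eqEsubset subsetI AX AI /= andbT.
  apply/subsetP => ij; rewrite in_setI => /andP[ijX ijI].
  apply: contraT => nA; have /setP/(_ ij) := XAI.
  by rewrite in_setI in_setD nA ijX ijI in_set0.
split; first exact: packed_pw.
split; first exact: setpar_pw.
split; first by rewrite -eqA subsetIr.
by apply/setP => ij; rewrite -eqA !in_setI in_setD in_setI in_set0; do 2!case: (ij \in _).
Qed.

Lemma inWAP A w : A \subset Xset B ->
  inWA B A w <-> exists2 s, w = pw B s & Xset B :&: invp s = A.
Proof.
move=> AX; split=> [wA|[s -> /inWA_pw]]; last exact.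
have [pw_w [setw _]] := wA; have [s def_w] := pw_surj partB pw_w setw.
by exists s => //; apply/inWA_pw; rewrite -?def_w.
Qed.

(** Covers preserve the set partition and the trace on [Xset B]; the equivalence makes the symmetry
    case immediate. *)
Lemma conn_inWA A u w : A \subset Xset B -> conn u w -> inWA B A u <-> inWA B A w.
Proof.
move=> AX; elim=> {u w} [u w cov_uw|u|u w _ IH|u v w _ IH1 _ IH2].
- have [pu [pw_w _]] := cov_uw; have eqS := covers_setpar cov_uw.
  split=> /(inWAP _ AX)[s def_s eqA]; apply/(inWAP _ AX).
    have setw : setpar w = B by rewrite -eqS def_s setpar_pw.
    have [t def_t] := pw_surj partB pw_w setw; exists t => //.
    by rewrite def_s def_t in cov_uw; have [_ <-] := covers_pw_weak_le cov_uw.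
  have setu : setpar u = B by rewrite eqS def_s setpar_pw.
  have [t def_t] := pw_surj partB pu setu; exists t => //.
  by rewrite def_s def_t in cov_uw; have [_ ->] := covers_pw_weak_le cov_uw.
- by [].
- by rewrite IH.
- by rewrite IH1.
Qed.

Lemma pwle_conn m (u w : m.-tuple nat) : pwle u w -> conn u w.
Proof.
elim=> {u w} [u w|u|u v w _ uv _]; [exact: rst_step | exact: rst_refl | exact: rst_trans uv].
Qed.

(** Two members of a class are both below their join, which stays in the class and so connects
    them. *)
Lemma inComp_inWA A w u : A \subset Xset B -> inWA B A w -> inComp w u <-> inWA B A u.
Proof.
move=> AX wA; split=> [[_ /(conn_inWA AX)->//]|uA]; split; first by case: uA.
have /(inWAP _ AX)[s -> eqs] := wA; have /(inWAP _ AX)[t -> eqt] := uA.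
have eqX : Xset B :&: invp t = Xset B :&: invp s by rewrite eqs.
have /and3P[tj sj _] := wjoinP t s.
have eqj := wjoin_left_initial (left_initial_Xset partB) eqX.
apply: (@rst_trans _ _ _ (pw B (wjoin t s))); last apply: rst_sym.
  by apply: pwle_conn; apply: weak_le_pwle.
by apply: pwle_conn; apply: weak_le_pwle => //; rewrite eqj.
Qed.

Lemma pwle_weak_le s t : pwle (pw B s) (pw B t) -> weak_le s t.
Proof.
(* Induction on the closure needs arbitrary endpoints; packedness and the set partition are carried
   along so that intermediate words are again of the form [pw B s]. *)
suff H (u w : n.-tuple nat) : pwle u w -> packed u -> setpar u = B ->
    [/\ packed w, setpar w = B & weak_le (delrpt B u) (delrpt B w)].
  by case/H; rewrite ?packed_pw ?setpar_pw // !delrpt_pw.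
elim=> {u w} [u w cov_uw|u|u v w _ IH1 _ IH2] pu setu.
- have [_ [pw_w _]] := cov_uw; have setw := covers_setpar cov_uw; rewrite setu in setw.
  have [s' def_u] := pw_surj partB pu setu.
  have [t' def_w] := pw_surj partB pw_w (esym setw).
  rewrite def_u def_w in cov_uw *; rewrite packed_pw ?setpar_pw // !delrpt_pw //.
  by have [] := covers_pw_weak_le cov_uw.
- by split=> //; apply: weak_le_refl.
- have [pv setv le_uv] := IH1 pu setu; have [pw_w setw le_vw] := IH2 pv setv.
  by split=> //; apply: weak_le_trans le_uv le_vw.
Qed.

End Order.

Theorem mainTheorem7 :
  (* (1) each nonempty W_A is a connected component *)
  (forall (n : nat) (B : {set {set 'I_n}}), partition B [set: 'I_n] ->
     forall A : {set 'I_#|B| * 'I_#|B|}, A \subset Xset B ->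
     forall w : n.-tuple nat, inWA B A w ->
     forall u : n.-tuple nat, inComp w u <-> inWA B A u)
  /\
  (* (2) every connected component arises this way *)
  (forall (n : nat) (w : n.-tuple nat), packed w ->
     exists B : {set {set 'I_n}}, partition B [set: 'I_n] /\
     exists A : {set 'I_#|B| * 'I_#|B|}, A \subset Xset B /\
     forall u : n.-tuple nat, inComp w u <-> inWA B A u)
  /\
  (* (3) each component W is a bounded lattice, order-isomorphic via delrpt
         to an interval of the weak order on S_k, with the join/meet formulas *)
  (forall (n : nat) (w0 : n.-tuple nat), packed w0 ->
     let W := inComp w0 in
     let B := setpar w0 in
     (exists bot top, W bot /\ W top /\
        forall u, W u -> pwle bot u /\ pwle u top)
     /\
     (exists s t : {perm 'I_#|B|}, weak_le s t /\
        (forall u, W u -> weak_le s (delrpt B u) /\ weak_le (delrpt B u) t) /\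
        (forall sigma, weak_le s sigma -> weak_le sigma t ->
           exists u, W u /\ delrpt B u = sigma) /\
        (forall u v, W u -> W v -> delrpt B u = delrpt B v -> u = v) /\
        (forall u v, W u -> W v ->
           (pwle u v <-> weak_le (delrpt B u) (delrpt B v))))
     /\
     (forall u v, W u -> W v ->
        is_joinW W u v (pw B (wjoin (delrpt B u) (delrpt B v))) /\
        is_meetW W u v (pw B (wmeet (delrpt B u) (delrpt B v))))).

Proof.
split; [|split].
- by move=> n B partB A AX w wA u; apply: inComp_inWA.
- move=> n w pw_w; have partB := partition_setpar w.
  (* The component is indexed by the trace on [Xset] of the inversions of [w] itself. *)
  exists (setpar w); split=> //; exists (Xset (setpar w) :&: InvW (setpar w) w).
  have AX := subsetIl (Xset (setpar w)) (InvW (setpar w) w).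
  split=> // u; apply: inComp_inWA => //; apply/(inWAP partB _ AX).
  have [s def_w] := pw_surj partB pw_w erefl; exists s => //.
  by rewrite -(InvW_pw partB s) -def_w.
move=> n w0 pw_w0 W B; have partB : partition B [set: 'I_n] := partition_setpar w0.
have [s0 def_w0] := pw_surj partB pw_w0 erefl.
pose X := Xset B; have AX : X :&: invp s0 \subset X := subsetIl _ _.
have liX : left_initial X := left_initial_Xset partB.
have w0A : inWA B (X :&: invp s0) w0 by apply/(inWAP partB _ AX); exists s0.
have WP u : W u <-> exists2 s, u = pw B s & X :&: invp s = X :&: invp s0.
  by rewrite -(inWAP partB _ AX); apply: inComp_inWA.
have Wpw s : X :&: invp s = X :&: invp s0 -> W (pw B s) by move=> eqX; apply/WP; exists s.
have [bot [top [le_bt eqb eqt classP]]] := class_interval s0 liX.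
have between s : X :&: invp s = X :&: invp s0 -> weak_le bot s /\ weak_le s top.
  by move/eqP; rewrite -classP => /andP.
split; [|split].
- exists (pw B bot), (pw B top); split; first exact: Wpw.
  split; first exact: Wpw.
  move=> _ /WP[s -> eqs]; have [bs st] := between s eqs.
  by split; apply: weak_le_pwle => //; rewrite eqs.
- exists bot, top; split=> //; split.
    by move=> _ /WP[s -> /between]; rewrite delrpt_pw.
  split.
    move=> s bs st; exists (pw B s); rewrite delrpt_pw //; split=> //; apply: Wpw.
    by apply/eqP; rewrite -classP bs.
  split.
    by move=> _ _ /WP[s -> _] /WP[t -> _]; rewrite !delrpt_pw // => ->.
  move=> _ _ /WP[s -> eqs] /WP[t -> eqt']; rewrite !delrpt_pw //.
  split=> [/(pwle_weak_le partB)//|st]; apply: weak_le_pwle => //; rewrite -/X.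
  by rewrite eqs.
move=> _ _ /WP[s -> eqs] /WP[t -> eqt']; rewrite !delrpt_pw //.
have eqX : X :&: invp s = X :&: invp t by rewrite eqs.
(* The join and meet in the symmetric group stay in the class, where [pwle] and [weak_le]
   correspond, so they are also those of [W]. *)
have eqj : X :&: invp (wjoin s t) = X :&: invp s0 by rewrite wjoin_left_initial.
have eqm : X :&: invp (wmeet s t) = X :&: invp s0 by rewrite wmeet_left_initial.
have /and3P[sj tj /forallP minj] := wjoinP s t.
have /and3P[ms mt /forallP maxm] := wmeetP s t.
have le_pw r r' : X :&: invp r = X :&: invp s0 -> X :&: invp r' = X :&: invp s0 ->
    weak_le r r' -> pwle (pw B r) (pw B r').
  by move=> eqr eqr' le_r; apply: weak_le_pwle => //; rewrite -/X eqr.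
split; do 3![split; first by [apply: Wpw | apply: le_pw]] => _ /WP[x -> eqx].
  move=> /(pwle_weak_le partB) sx /(pwle_weak_le partB) tx; apply: le_pw => //.
  by have := minj x; rewrite sx tx.
move=> /(pwle_weak_le partB) xs /(pwle_weak_le partB) xt; apply: le_pw => //.
by have := maxm x; rewrite xs xt.
Qed.
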